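(* Let $X$ be a topological space, $\mathcal N$ a $\pi$-net of $X$, $\mathcal W\subset\mathfrak W(X)$ and $\Upsilon,\Psi\in\mathfrak U(X)$. If $\mathcal W$ is a monolithic family, then $$OD(X,\mathcal N,\mathcal W)\sim OD(X,\mathcal N,\mathcal W;\Upsilon,\Psi)\qquad\text{and}\qquad DO(X,\mathcal N,\mathcal W)\sim DO(X,\mathcal N,\mathcal W;\Upsilon,\Psi).$$
   Context: Let $\mathcal T$ be the topology of $X$, $\mathcal T^*=\mathcal T\setminus\{\varnothing\}$, $\omega=\{0,1,2,\dots\}$. A $\pi$-net of $X$ is a family of nonempty subsets of $X$ such that every nonempty open subset of $X$ contains a member of the family. $\mathfrak V(X)$ is the set of all sequences $(V_n)_{n\in\omega}$ of members of $\mathcal T^*$ with $V_{n+1}\subset V_n$ for all $n$. $\mathfrak W(X)$ is the set of all sequences $(V_n,M_n)_{n\in\omega}$ with $V_n\in\mathcal T^*$, $\varnothing\ne M_n\subset X$, $V_{n+1}\subset V_n$ and $M_{n+1}\subset V_n$ for all $n$. $\mathfrak U(X)$ is the set of all maps $\Upsilon$ assigning to each $U\in\mathcal T^*$ a $\pi$-base $\Upsilon(U)$ of $U$, i.e. a family of nonempty open subsets of $U$ such that every nonempty open subset of $U$ contains a member of the family. $\Upsilon_t(X)\in\mathfrak U(X)$ is the map $U\mapsto\{V\in\mathcal T^*:V\subset U\}$. A family $\mathcal W\subset\mathfrak W(X)$ is monolithic if: whenever $(U_n)\in\mathfrak V(X)$, $(V_n,M_n)_n\in\mathcal W$ and $U_{n+1}\subset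 V_n\subset U_n$ for all $n\in\omega$, then $(U_n,M_n)_n\in\mathcal W$. Games $OD(X,\mathcal N,\mathcal W;\Upsilon,\Psi)$ and $DO(X,\mathcal N,\mathcal W;\Upsilon,\Psi)$: there are two players $\alpha,\beta$. On move $0$, $\alpha$ plays $U_0=X$ in the game $OD$, and $U_0\in\Upsilon(X)$ in the game $DO$; then $\beta$ chooses $V_0\in\Psi(U_0)$ and $M_0\in\mathcal N$ with $M_0\subset U_0$. On move $n\ge1$, $\alpha$ chooses $U_n\in\Upsilon(V_{n-1})$ and then $\beta$ chooses $V_n\in\Psi(U_n)$ and $M_n\in\mathcal N$ with $M_n\subset U_n$. Player $\alpha$ wins if $(V_n,M_n)_{n\in\omega}\in\mathcal W$; otherwise $\beta$ wins. Strategies may depend on all previous moves. Put $OD(X,\mathcal N,\mathcal W)=OD(X,\mathcal N,\mathcal W;\Upsilon_t(X),\Upsilon_t(X))$ and $DO(X,\mathcal N,\mathcal W)=DO(X,\mathcal N,\mathcal W;\Upsilon_t(X),\Upsilon_t(X))$. A game is $\kappa$-favorable if player $\kappa$ has a winning strategy in it. $G_1\sim G_2$ means that for each $\kappa\in\{\alpha,\beta\}$, $G_1$ is $\kappa$-favorable if and only if $G_2$ is $\kappa$-favorable. *)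

(* Defs.v *)
(* MathComp-Analysis *)
From mathcomp Require Import all_boot.
From mathcomp Require Import all_classical topology.

Set Implicit Arguments.
Unset Strict Implicit.
Unset Printing Implicit Defensive.

Local Open Scope classical_set_scope.

Section Families.
Variable X : topologicalType.

Definition Tstar : set (set X) := [set U | open U /\ U !=set0].

Definition pi_net (N : set (set X)) : Prop :=
  (forall M, N M -> M !=set0) /\
  (forall U, Tstar U -> exists2 M, N M & M `<=` U).

Definition pi_base_of (U : set X) (B : set (set X)) : Prop :=
  (forall V, B V -> Tstar V /\ V `<=` U) /\
  (forall W, Tstar W -> W `<=` U -> exists2 V, B V & V `<=` W).

Definition frakV : set (nat -> set X) :=
  [set V | forall n, Tstar (V n) /\ V n.+1 `<=` V n].

(* A term of a sequence is the pair (V_n, M_n). *)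
Definition frakW : set (nat -> set X * set X) :=
  [set s | forall n, [/\ Tstar (s n).1, (s n).2 !=set0,
                         (s n.+1).1 `<=` (s n).1 & (s n.+1).2 `<=` (s n).1]].

(* A map on the nonempty open sets is encoded as a total function on [set X]
   whose values at non-open sets are never used.  At U = set0 the condition
   says only that [Ups set0] is empty; this value is used only if X is empty. *)
Definition frakU : set (set X -> set (set X)) :=
  [set Ups | forall U, open U -> pi_base_of U (Ups U)].

Definition Ups_t : set X -> set (set X) :=
  fun U => [set V | Tstar V /\ V `<=` U].

Definition monolithic (W : set (nat -> set X * set X)) : Prop :=
  forall (U : nat -> set X) (s : nat -> set X * set X),
    frakV U -> W s ->
    (forall n, U n.+1 `<=` (s n).1 /\ (s n).1 `<=` U n) ->
    W (fun n => (U n, (s n).2)).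

End Families.

Inductive player := alpha | beta.

(* In round n, alpha plays in A, then beta plays in B.  Legality of a move is
   judged from the completed rounds (in chronological order) and, for beta,
   alpha's move in the current round. *)
Record game (A B : Type) := Game {
  alpha_legal : seq (A * B) -> set A;
  beta_legal : seq (A * B) -> A -> set B;
  alpha_wins : (nat -> A * B) -> Prop }.

Section Strategies.
Variables (A B : Type) (G : game A B).
Implicit Type p : nat -> A * B.

Definition alpha_follows (sigma : seq (A * B) -> A) p n : Prop :=
  (p n).1 = sigma (mkseq p n) /\ beta_legal G (mkseq p n) (p n).1 (p n).2.

Definition beta_follows (tau : seq (A * B) -> A -> B) p n : Prop :=
  alpha_legal G (mkseq p n) (p n).1 /\ (p n).2 = tau (mkseq p n) (p n).1.

(* A winning strategy must prescribe a legal move at every position reached by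
   following it against legal play, and win every infinite play so obtained. *)
Definition alpha_winning (sigma : seq (A * B) -> A) : Prop :=
  (forall p n, (forall i, (i < n)%N -> alpha_follows sigma p i) ->
     alpha_legal G (mkseq p n) (sigma (mkseq p n))) /\
  (forall p, (forall n, alpha_follows sigma p n) -> alpha_wins G p).

Definition beta_winning (tau : seq (A * B) -> A -> B) : Prop :=
  (forall p n, (forall i, (i < n)%N -> beta_follows tau p i) ->
     forall a, alpha_legal G (mkseq p n) a ->
       beta_legal G (mkseq p n) a (tau (mkseq p n) a)) /\
  (forall p, (forall n, beta_follows tau p n) -> ~ alpha_wins G p).

Definition favorable (k : player) : Prop :=
  match k with
  | alpha => exists sigma, alpha_winning sigma
  | beta => exists tau, beta_winning tau
  end.

End Strategies.

Definition game_equiv (A B : Type) (G1 G2 : game A B) : Prop :=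
  forall k : player, favorable G1 k <-> favorable G2 k.

Section Games.
Variables (X : topologicalType) (N : set (set X)).
Variable W : set (nat -> set X * set X).
Variables Ups Psi : set X -> set (set X).

(* alpha plays U_n and beta plays (V_n, M_n); [start] is the family from which
   U_0 is chosen.  In the history [r :: h], [(last r h).2.1] is V_{n-1}. *)
Definition OD_DO_game (start : set (set X)) : game (set X) (set X * set X) :=
  {| alpha_legal := fun h =>
       if h is r :: h' then Ups (last r h').2.1 else start;
     beta_legal := fun _ U =>
       [set VM | [/\ Psi U VM.1, N VM.2 & VM.2 `<=` U]];
     alpha_wins := fun p => W (fun n => (p n).2) |}.

Definition OD : game (set X) (set X * set X) := OD_DO_game [set setT].

Definition DO : game (set X) (set X * set X) := OD_DO_game (Ups setT).

End Games.

(* Main.v *)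
Require Import Defs.
From mathcomp Require Import all_boot.
From mathcomp Require Import all_classical topology.

Set Implicit Arguments.
Unset Strict Implicit.
Unset Printing Implicit Defensive.

Local Open Scope classical_set_scope.

(** Why the restricted games are no different.  Run two games [G] and [G'] with
    the same [N] and [W] side by side, keeping in every round
<<
      V'_n `<=` V_n `<=` U_n `<=` U'_n    and    M'_n = M_n.
>>
    Alpha can keep this up in [G] while a strategy of hers moves in [G'], and
    beta can keep it up in [G'] while a strategy of his moves in [G]: whoever
    translates only ever has to shrink a nonempty open set to a member of a
    pi-base, both when copying his own strategy's move to the real board and
    when copying the opponent's move to the imagined one.  Since
    [U'_n.+1 `<=` V'_n], the two plays then interleave,
<<
      V_n.+1 `<=` U_n.+1 `<=` U'_n.+1 `<=` V'_n `<=` V_n,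
>>
    and this is the pattern in which monolithicity turns a win of alpha in [G']
    into a win of alpha in [G] ([nested_win]).  So a winning strategy of alpha
    passes from [G'] to [G] and one of beta from [G] to [G']
    ([alpha_transfer], [beta_transfer]).  The situation is symmetric in the two
    pairs of pi-base assignments, so exchanging them gives equivalence
    ([OD_DO_game_equiv]).  The two kinds of game differ only in the family from
    which [U_0] is taken, and all that matters about these families is that
    each member of one contains a member of the other: this holds for [{X}]
    and itself, and for any two pi-bases of [X]. *)

(** Translates a history round by round; [step] sees the translated history so
    far, which is what a strategy for the imagined game has to be fed with. *)
Definition shadow (R S : Type) (step : seq S -> R -> S) (h : seq R) : seq S :=
  foldl (fun h' r => rcons h' (step h' r)) [::] h.

Definition shadow_play (R S : Type) (step : seq S -> R -> S) (p : nat -> R)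
    (n : nat) : S :=
  step (shadow step (mkseq p n)) (p n).

Lemma shadow_mkseq (R S : Type) (step : seq S -> R -> S) (p : nat -> R) n :
  shadow step (mkseq p n) = mkseq (shadow_play step p) n.
Proof.
elim: n => [//|n IHn].
by rewrite !mkseqS -IHn /shadow foldl_rcons.
Qed.

Section Transfer.
Variable X : topologicalType.
Implicit Types (U V O : set X) (B : set (set X)).

Definition finer B B' : Prop := forall O, B' O -> exists2 U, B U & U `<=` O.

Definition shrink B O : set X := xget O [set U | B U /\ U `<=` O].

Lemma shrinkP B O : (exists2 U, B U & U `<=` O) ->
  B (shrink B O) /\ shrink B O `<=` O.
Proof.
case=> U BU UO; have: exists V, [set V | B V /\ V `<=` O] V by exists U.
by move/(xgetPex O).
Qed.

(** The chain [V' `<=` V `<=` U `<=` U'] between simultaneous rounds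
    [r = (U, (V, M))] and [r' = (U', (V', M'))] of the two games; both
    transfers maintain it, with real and imagined play exchanging roles. *)
Record nested (r r' : set X * (set X * set X)) : Prop := Nested {
  nested_inner : Tstar r.2.1;
  nested_outer : Tstar r'.2.1;
  nested_replies : r'.2.1 `<=` r.2.1;
  nested_legal : r.2.1 `<=` r.1;
  nested_moves : r.1 `<=` r'.1;
  nested_net : r.2.2 = r'.2.2 }.

Variables (N : set (set X)) (W : set (nat -> set X * set X)).
Hypothesis monoW : monolithic W.

(** The hypotheses say [V_n.+1 `<=` V'_n `<=` V_n], so [W] passes from the
    primed sequence to the unprimed one. *)
Lemma nested_win (p p' : nat -> set X * (set X * set X)) :
  (forall n, nested (p n) (p' n)) ->
  (forall n, (p' n.+1).1 `<=` (p' n).2.1) ->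
  W (fun n => (p' n).2) -> W (fun n => (p n).2).
Proof.
move=> pp' p'desc Wp'.
have VV' n : (p n.+1).2.1 `<=` (p' n).2.1.
  apply: subset_trans (p'desc n).
  exact: subset_trans (nested_legal (pp' n.+1)) (nested_moves (pp' n.+1)).
have -> : (fun n => (p n).2) = (fun n => ((p n).2.1, (p' n).2.2)).
  by apply/funext => n; rewrite -(nested_net (pp' n)) -surjective_pairing.
apply: (monoW (U := fun n => (p n).2.1) _ Wp') => n; split=> //.
- exact: nested_inner (pp' n).
- exact: subset_trans (VV' n) (nested_replies (pp' n)).
- exact: nested_replies (pp' n).
Qed.

Variables Ups Psi Ups' Psi' : set X -> set (set X).
Hypotheses (Ups_base : frakU Ups) (Psi_base : frakU Psi).
Hypotheses (Ups'_base : frakU Ups') (Psi'_base : frakU Psi').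
Variables start start' : set (set X).
Hypotheses (start_open : start `<=` open) (start'_open : start' `<=` open).
Hypothesis start_finer : finer start start'.

Let G := OD_DO_game N W Ups Psi start.
Let G' := OD_DO_game N W Ups' Psi' start'.
Implicit Types p : nat -> set X * (set X * set X).

Lemma alpha_legalS (Ups0 Psi0 : set X -> set (set X)) start0 p n :
  alpha_legal (OD_DO_game N W Ups0 Psi0 start0) (mkseq p n.+1) =
  Ups0 (p n).2.1.
Proof. by rewrite mkseqS; case: (mkseq p n) => [|r h] //=; rewrite last_rcons. Qed.

(** As [V'_n.-1 `<=` V_n.-1], an outer move [U'] is a nonempty open subset of
    [V_n.-1] and so contains a member of its pi-base. *)
Lemma finer_legal p p' n : (forall i, (i < n)%N -> nested (p i) (p' i)) ->
  [/\ finer (alpha_legal G (mkseq p n)) (alpha_legal G' (mkseq p' n)),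
      alpha_legal G (mkseq p n) `<=` open &
      alpha_legal G' (mkseq p' n) `<=` open].
Proof.
case: n => [//|n] /(_ n (ltnSn n)) [[oV _] [oV' _] V'V _ _ _].
rewrite !alpha_legalS.
have [subV finV] := Ups_base oV; have [subV' _] := Ups'_base oV'.
split=> [U' /subV'[tU' U'V']|U /subV[[]]//|U' /subV'[[]]//].
exact: finV tU' (subset_trans U'V' V'V).
Qed.

(** The play in [G] is real, the one in [G'] imagined.  Alpha shrinks the
    [U'_n] prescribed by [sigma] to her own [U_n], then shrinks beta's reply
    [V_n] to the [V'_n] that she pretends he chose; his [M_n] stays legal since
    it lies in [U_n `<=` U'_n]. *)
Lemma alpha_transfer : favorable G' alpha -> favorable G alpha.
Proof.
case=> sigma [sigma_legal sigma_win].
pose step h' (r : set X * (set X * set X)) :=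
  (sigma h', (shrink (Psi' (sigma h')) r.2.1, r.2.2)).
pose rho h := shrink (alpha_legal G h) (sigma (shadow step h)).
have rhoP p n (p' := shadow_play step p) :
    (forall i, (i < n)%N -> alpha_follows G' sigma p' i) ->
    (forall i, (i < n)%N -> nested (p i) (p' i)) ->
  alpha_legal G (mkseq p n) (rho (mkseq p n)) /\
  rho (mkseq p n) `<=` sigma (mkseq p' n).
  move=> foll nest; rewrite /rho shadow_mkseq; apply: shrinkP.
  by have [fin _ _] := finer_legal nest; apply: fin; apply: sigma_legal.
have follow p (p' := shadow_play step p) n :
    (forall i, (i < n)%N -> alpha_follows G rho p i) ->
  forall i, (i < n)%N -> alpha_follows G' sigma p' i /\ nested (p i) (p' i).
  elim: n => [//|n IHn] foll.
  have /IHn IH i : (i < n)%N -> alpha_follows G rho p i.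
    by move=> /ltnW ?; apply: foll.
  have foll' i : (i < n)%N -> alpha_follows G' sigma p' i by case/IH.
  have nest i : (i < n)%N -> nested (p i) (p' i) by case/IH.
  move=> i; rewrite ltnS leq_eqVlt => /predU1P[->{i}|]; last exact: IH.
  have [legU UU'] := rhoP p n foll' nest.
  have [_ oU oU'] := finer_legal nest.
  have [pE [PsiV NM MU]] := foll n (ltnSn n).
  rewrite -pE in legU UU'.
  (* The imagined round is computed from the imagined history, so it follows
     [sigma] by construction. *)
  have p'E : p' n = step (mkseq p' n) (p n).
    by rewrite {1}/p' /shadow_play shadow_mkseq.
  have legU' := sigma_legal _ _ foll'.
  have [/(_ _ PsiV)[tV VU] _] := Psi_base (oU _ legU).
  have [subU' /(_ _ tV (subset_trans VU UU'))] := Psi'_base (oU' _ legU').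
  move=> /shrinkP[PsiV' V'V].
  rewrite /alpha_follows p'E; split; first split=> //.
    by split=> //; apply: subset_trans UU'.
  by split=> //; have [] := subU' _ PsiV'.
exists rho; split=> [p n foll|p foll].
  by have [] // := rhoP p n => i /(follow p n foll)[].
pose p' := shadow_play step p.
have foll' n : alpha_follows G' sigma p' n /\ nested (p n) (p' n).
  by apply: (follow p n.+1) => // i _; apply: foll.
apply: (@nested_win p p') => [n|n|]; first by have [] := foll' n.
  have [[p'E _] _] := foll' n.+1.
  have: alpha_legal G' (mkseq p' n.+1) (p' n.+1).1.
    by rewrite p'E; apply: sigma_legal => i _; have [] := foll' i.
  rewrite alpha_legalS; have [_ /nested_outer[oV' _]] := foll' n.
  by have [subV' _] := Ups'_base oV' => /subV'[].
by apply: sigma_win => n; have [] := foll' n.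
Qed.

(** Now the play in [G'] is real and the one in [G] imagined.  Beta shrinks
    alpha's [U'_n] to the [U_n] that he pretends she chose, lets [tau] answer
    with [(V_n, M_n)], and plays some [V'_n `<=` V_n] with the same [M_n]; a win
    of alpha in the real play would be one against [tau]. *)
Lemma beta_transfer : favorable G beta -> favorable G' beta.
Proof.
case=> tau [tau_legal tau_win].
pose answer h U' :=
  let U := shrink (alpha_legal G h) U' in (U, tau h U).
pose step h (r' : set X * (set X * set X)) := answer h r'.1.
pose rho h' U' :=
  let r := answer (shadow step h') U' in (shrink (Psi' U') r.2.1, r.2.2).
have rhoP p' n U' (p := shadow_play step p') (r := answer (mkseq p n) U') :
    (forall i, (i < n)%N -> beta_follows G tau p i) ->
    (forall i, (i < n)%N -> nested (p i) (p' i)) ->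
    alpha_legal G' (mkseq p' n) U' ->
  [/\ alpha_legal G (mkseq p n) r.1, nested r (U', rho (mkseq p' n) U') &
      beta_legal G' (mkseq p' n) U' (rho (mkseq p' n) U')].
  move=> foll nest legU'.
  have [fin oU oU'] := finer_legal nest.
  have [legU UU'] := shrinkP (fin _ legU').
  have [PsiV NM MU] := tau_legal _ _ foll _ legU.
  have [/(_ _ PsiV)[tV VU] _] := Psi_base (oU _ legU).
  have [subU' /(_ _ tV (subset_trans VU UU'))] := Psi'_base (oU' _ legU').
  move=> /shrinkP[PsiV' V'V]; have [tV' _] := subU' _ PsiV'.
  rewrite /rho shadow_mkseq; split=> //.
  by split=> //; apply: subset_trans UU'.
have follow p' (p := shadow_play step p') n :
    (forall i, (i < n)%N -> beta_follows G' rho p' i) ->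
  forall i, (i < n)%N -> beta_follows G tau p i /\ nested (p i) (p' i).
  elim: n => [//|n IHn] foll.
  have /IHn IH i : (i < n)%N -> beta_follows G' rho p' i.
    by move=> /ltnW ?; apply: foll.
  move=> i; rewrite ltnS leq_eqVlt => /predU1P[->{i}|]; last exact: IH.
  have [legU' p'E] := foll n (ltnSn n).
  have [] // := rhoP p' n (p' n).1.
  - by move=> i /IH[].
  - by move=> i /IH[].
  rewrite -p'E -surjective_pairing -/p => legU nest _.
  have pE : p n = answer (mkseq p n) (p' n).1.
    by rewrite {1}/p /shadow_play shadow_mkseq.
  by rewrite /beta_follows pE.
exists rho; split=> [p' n foll U' legU'|p' foll].
  by have [] // := rhoP p' n U' => i /(follow p' n foll)[].
pose p := shadow_play step p'.
have foll' n : beta_follows G tau p n /\ nested (p n) (p' n).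
  by apply: (follow p' n.+1) => // i _; apply: foll.
move=> Wp'; apply: (tau_win p) => [n|]; first by have [] := foll' n.
apply: (@nested_win p p') Wp' => n; first by have [] := foll' n.
have [] := foll n.+1; rewrite alpha_legalS.
have [_ /nested_outer[oV' _]] := foll' n.
by have [subV' _] := Ups'_base oV' => /subV'[].
Qed.

End Transfer.

Lemma OD_DO_game_equiv (X : topologicalType) (N : set (set X))
    (W : set (nat -> set X * set X)) (Ups Psi Ups' Psi' : set X -> set (set X))
    (start start' : set (set X)) :
  monolithic W -> frakU Ups -> frakU Psi -> frakU Ups' -> frakU Psi' ->
  start `<=` open -> start' `<=` open ->
  finer start start' -> finer start' start ->
  game_equiv (OD_DO_game N W Ups Psi start) (OD_DO_game N W Ups' Psi' start').
Proof.
by move=> *; case; split; by [apply: alpha_transfer | apply: beta_transfer].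
Qed.

Lemma Ups_t_frakU (X : topologicalType) : frakU (@Ups_t X).
Proof. by move=> U oU; split=> // O tO OU; exists O. Qed.

Lemma pi_base_finer (X : topologicalType) (U : set X) (B B' : set (set X)) :
  pi_base_of U B -> pi_base_of U B' -> finer B B'.
Proof. by move=> [_ BP] [B'P _] O /B'P[]; apply: BP. Qed.

Lemma pi_base_open (X : topologicalType) (U : set X) (B : set (set X)) :
  pi_base_of U B -> B `<=` open.
Proof. by move=> [BP _] O /BP[[]]. Qed.

Theorem proposition2 (X : topologicalType) (N : set (set X))
  (W : set (nat -> set X * set X)) (Ups Psi : set X -> set (set X))
  (hN : pi_net N) (hW : W `<=` @frakW X)
  (hUps : @frakU X Ups) (hPsi : @frakU X Psi)
  (hmono : monolithic W) :
  game_equiv (OD N W (@Ups_t X) (@Ups_t X)) (OD N W Ups Psi) /\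
  game_equiv (DO N W (@Ups_t X) (@Ups_t X)) (DO N W Ups Psi).
Proof.
have base_t := @Ups_t_frakU X; have oT := @openT X.
have startT : [set [set: X]] `<=` open by move=> _ ->.
have finT : finer [set [set: X]] [set setT] by move=> O ->; exists setT.
split; apply: OD_DO_game_equiv => //.
- exact: pi_base_open (base_t _ oT).
- exact: pi_base_open (hUps _ oT).
- exact: pi_base_finer (base_t _ oT) (hUps _ oT).
- exact: pi_base_finer (hUps _ oT) (base_t _ oT).
Qed.
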